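(* Let $(\Omega,\Sigma,\mu)$ be a $\sigma$-finite measure space and let $K\subset L^1(\mu)$ be nonempty, bounded, closed, convex and measure-compact. Let $T:K\to K$ be nonexpansive, let $\delta>0$, and let $Q:K\to K$ be a map (not necessarily linear, continuous or nonexpansive) with $Q\circ Q=Q$ and $\|Q(f)-f\|_1\le\delta$ for all $f\in K$. Put $\widetilde T:=Q\circ T$. Then there exists $x\in K$ with $\|\widetilde T(x)-x\|_1\le\delta$; in fact every fixed point $x^*\in K$ of $T$ satisfies $\|\widetilde T(x^* )-x^*\|_1\le\delta$, and if moreover $x^*\in Q(K)$ then $\widetilde T(x^* )=x^*$. In particular, for every $\epsilon>\delta$ there exists $x\in K$ with $\|\widetilde T(x)-x\|_1<\epsilon$.
   Context: ''Bounded'' and ''closed'' refer to the norm $\|\cdot\|_1$ of $L^1(\mu)$. A set $K\subset L^1(\mu)$ is measure-compact if it is compact with respect to the topology of local convergence in measure, i.e. the topology in which $f_n\to f$ means $f_n\to f$ in measure on every measurable subset of $\Omega$ of finite measure. A map $T:K\to K$ is nonexpansive if $\|T(f)-T(g)\|_1\le\|f-g\|_1$ for all $f,g\in K$. *)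

(* Defs.v *)
From HB Require Import structures.
From mathcomp Require Import all_boot all_order all_algebra.
From mathcomp Require Import all_classical all_reals all_analysis.
From mathcomp Require Import measurable_realfun.

Set Implicit Arguments.
Unset Strict Implicit.
Unset Printing Implicit Defensive.
Import Order.TTheory GRing.Theory Num.Theory.
Import numFieldNormedType.Exports.
Local Open Scope classical_set_scope.
Local Open Scope ring_scope.
Local Open Scope quotient_scope.

Section L1_space.
Context d (T : measurableType d) (R : realType).
Variable mu : {measure set T -> \bar R}.

(* The library's space of classes modulo a.e. equality; its linear and normed
   structure is supplied below. *)
Definition L1 : Type := LspaceType1 mu.

(* A representative of the class; meaningful up to a.e. equality. *)
Definition L1_fun (f : L1) : T -> R := aqEqMfun_to_fun (LebesgueSpace.sort f).

HB.instance Definition _ := gen_eqMixin L1.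
HB.instance Definition _ := gen_choiceMixin L1.

End L1_space.
Coercion L1_fun : L1 >-> Funclass.

Section L1_class.
Context d (T : measurableType d) (R : realType).
Variable mu : {measure set T -> \bar R}.
Implicit Types (f g : L1 mu) (u v : T -> R).

Lemma L1_Lfun f : (f : T -> R) \in Lfun mu 1.
Proof.
rewrite inE; apply/andP; split; rewrite inE.
  exact: (@measurable_funPT _ _ _ _ (repr (LebesgueSpace.sort f))).
exact: (@Lebesgue_finite _ _ _ _ _ _ f).
Qed.

Lemma measurable_L1 f : measurable_fun setT (f : T -> R).
Proof. by have /andP[+ _] := L1_Lfun f; rewrite inE. Qed.

Lemma L1_ext f g : (f : T -> R) = g %[ae mu] -> f = g.
Proof.
case: f => f [[hf]]; case: g => g [[hg]] fg.
have efg : f = g.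
  by rewrite -[f]reprK -[g]reprK; apply/eqmodP/asboolP; exact: fg.
by case: _ / efg in hg fg *; rewrite (Prop_irrelevance hf hg).
Qed.

Lemma measurable_norm_EFin u : measurable_fun setT u ->
  measurable_fun setT (abse \o (EFin \o u)).
Proof. by move=> mfu; apply: measurableT_comp => //; exact/measurable_EFinP. Qed.

Lemma L1_subproof u : u \in Lfun mu 1 ->
  exists f : L1 mu, (f : T -> R) = u %[ae mu].
Proof.
move=> /andP[]; rewrite !inE => mfu finu.
pose U : {mfun T >-> measurableTypeR R} :=
  HB.pack u (@isMeasurableFun.Build _ _ T (measurableTypeR R) u mfu).
pose q : {mfun_ mu, T >-> measurableTypeR R} := \pi U.
have eq_qu : (repr q : T -> R) = u %[ae mu].
  have /eqmodP/asboolP : repr q = U %[mod {mfun_ mu, T >-> measurableTypeR R}].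
    by rewrite reprK.
  exact.
have finq : finite_norm mu 1 (aqEqMfun_to_fun q).
  move: finu; rewrite /= /finite_norm !Lnorm1; apply: le_lt_trans.
  rewrite le_eqVlt; apply/orP; left; apply/eqP.
  apply: ae_eq_integral => //.
  - exact/measurable_norm_EFin/(@measurable_funPT _ _ _ _ (repr q)).
  - exact/measurable_norm_EFin.
  - by apply: filterS eq_qu => x e _; congr (abse (EFin _)); exact: e.
by exists (HB.pack q (isFinLebesgue.Build _ _ _ mu _ (lexx 1%E) q finq)
  : LspaceType1 mu).
Qed.

Definition L1_class u (hu : u \in Lfun mu 1) : L1 mu :=
  sval (cid (L1_subproof hu)).

Lemma L1_classE u (hu : u \in Lfun mu 1) :
  (L1_class hu : T -> R) = u %[ae mu].
Proof. exact: (svalP (cid (L1_subproof hu))). Qed.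

Lemma Lfun_cst0 : (cst 0 : T -> R) \in Lfun mu 1.
Proof. exact: rpred0. Qed.
Lemma Lfun_L1N f : \- (f : T -> R) \in Lfun mu 1.
Proof. by rewrite rpredN L1_Lfun. Qed.
Lemma Lfun_L1D f g : (f : T -> R) \+ g \in Lfun mu 1.
Proof. apply: rpredD; exact: L1_Lfun. Qed.
Lemma Lfun_L1Z (a : R) f : (fun x => a * f x) \in Lfun mu 1.
Proof. apply: (rpredZ a); exact: L1_Lfun. Qed.

Definition L1_zero : L1 mu := L1_class Lfun_cst0.
Definition L1_opp f : L1 mu := L1_class (Lfun_L1N f).
Definition L1_add f g : L1 mu := L1_class (Lfun_L1D f g).
Definition L1_scale (a : R) f : L1 mu := L1_class (Lfun_L1Z a f).
Definition L1_norm f : R := fine ('N[mu]_1[EFin \o f])%E.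

End L1_class.

Section L1_normedModule.
Context d (T : measurableType d) (R : realType).
Variable mu : {measure set T -> \bar R}.
Local Notation L1 := (L1 mu).
Implicit Types f g h : L1.

Let addE f g : (L1_add f g : T -> R) = f \+ g %[ae mu].
Proof. exact: L1_classE. Qed.
Let oppE f : (L1_opp f : T -> R) = \- f %[ae mu].
Proof. exact: L1_classE. Qed.
Let zeroE : (L1_zero mu : T -> R) = cst 0 %[ae mu].
Proof. exact: L1_classE. Qed.
Let scaleE a f : (L1_scale a f : T -> R) = (fun x => a * f x) %[ae mu].
Proof. exact: L1_classE. Qed.

Let addA : associative (@L1_add _ _ _ mu).
Proof.
move=> f g h; apply: L1_ext.
apply: filterS (filterI (filterI (addE f (L1_add g h)) (addE g h))
  (filterI (addE (L1_add f g) h) (addE f g))) => x [[e1 e2] [e3 e4]] _.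
by rewrite e1//= e2//= e3//= e4//= addrA.
Qed.

Let addC : commutative (@L1_add _ _ _ mu).
Proof.
move=> f g; apply: L1_ext; apply: filterS (filterI (addE f g) (addE g f)) => x [e1 e2] _.
by rewrite e1//= e2//= addrC.
Qed.

Let add0 : left_id (L1_zero mu) (@L1_add _ _ _ mu).
Proof.
move=> f; apply: L1_ext; apply: filterS (filterI (addE (L1_zero mu) f) zeroE) => x [e1 e2] _.
by rewrite e1//= e2//= add0r.
Qed.

Let addN : left_inverse (L1_zero mu) (@L1_opp _ _ _ mu) (@L1_add _ _ _ mu).
Proof.
move=> f; apply: L1_ext; apply: filterS (filterI (addE (L1_opp f) f) (filterI zeroE (oppE f))).
by move=> x [e1 [e2 e3]] _; rewrite e1//= e2//= e3//= addNr.
Qed.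

HB.instance Definition _ := GRing.isZmodule.Build L1 addA addC add0 addN.

Let scaleA a b f : L1_scale a (L1_scale b f) = L1_scale (a * b) f.
Proof.
apply: L1_ext.
apply: filterS (filterI (scaleE a (L1_scale b f))
  (filterI (scaleE b f) (scaleE (a * b) f))) => x [e1 [e2 e3]] _.
by rewrite e1//= e2//= e3//= mulrA.
Qed.

Let scale1 : left_id 1 (@L1_scale _ _ _ mu).
Proof.
move=> f; apply: L1_ext; apply: filterS (scaleE 1 f) => x e _.
by rewrite e//= mul1r.
Qed.

Let scaleDr : right_distributive (@L1_scale _ _ _ mu) +%R.
Proof.
move=> a f g; apply: L1_ext.
apply: filterS (filterI (filterI (scaleE a (L1_add f g)) (addE f g))
  (filterI (addE (L1_scale a f) (L1_scale a g))
    (filterI (scaleE a f) (scaleE a g)))) => x [[e1 e2] [e3 [e4 e5]]] _.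
by rewrite e1//= e2//= e3//= e4//= e5//= mulrDr.
Qed.

Let scaleDl f : {morph (@L1_scale _ _ _ mu)^~ f : a b / a + b}.
Proof.
move=> a b; apply: L1_ext.
apply: filterS (filterI (filterI (scaleE (a + b) f)
  (addE (L1_scale a f) (L1_scale b f)))
  (filterI (scaleE a f) (scaleE b f))) => x [[e1 e2] [e3 e4]] _.
by rewrite e1//= e2//= e3//= e4//= mulrDl.
Qed.

HB.instance Definition _ :=
  GRing.Zmodule_isLmodule.Build R L1 scaleA scale1 scaleDr scaleDl.

Lemma L1_addE f g : ((f + g : L1) : T -> R) = (f : T -> R) \+ g %[ae mu].
Proof. exact: addE. Qed.
Lemma L1_oppE f : ((- f : L1) : T -> R) = \- (f : T -> R) %[ae mu].
Proof. exact: oppE. Qed.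
Lemma L1_subE f g : ((f - g : L1) : T -> R) = (f : T -> R) \- g %[ae mu].
Proof.
apply: filterS (filterI (L1_addE f (- g)) (L1_oppE g)) => x [e1 e2] _.
by rewrite e1//= e2.
Qed.
Lemma L1_zeroE : ((0 : L1) : T -> R) = cst 0 %[ae mu].
Proof. exact: zeroE. Qed.
Lemma L1_scaleE a f : ((a *: f : L1) : T -> R) = (fun x => a * f x) %[ae mu].
Proof. exact: scaleE. Qed.

Let L1_normK f : (L1_norm f)%:E = (\int[mu]_x `|(f x)%:E|)%E.
Proof.
have /andP[_] := L1_Lfun f; rewrite inE /= /finite_norm /L1_norm => fn.
by rewrite fineK ?Lnorm1// -Lnorm1 fin_numElt fn (lt_le_trans ltNy0)// Lnorm_ge0.
Qed.

Let mnorm f : measurable_fun setT (abse \o (EFin \o f)).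
Proof. exact/measurable_norm_EFin/measurable_L1. Qed.

Let normD f g : L1_norm (f + g) <= L1_norm f + L1_norm g.
Proof.
rewrite -lee_fin EFinD !L1_normK -ge0_integralD//; try exact: mnorm.
apply: ae_ge0_le_integral => //.
- exact: mnorm.
- by move=> x _; rewrite adde_ge0.
- by apply: emeasurable_funD; exact: mnorm.
- apply: filterS (L1_addE f g) => x e _.
  by rewrite e//= lee_fin ler_normD.
Qed.

Let normZ a f : L1_norm (a *: f) = `|a| * L1_norm f.
Proof.
apply: EFin_inj; rewrite EFinM !L1_normK -ge0_integralZl//; last exact: mnorm.
apply: ae_eq_integral => //.
- exact: mnorm.
- by apply: measurable_funeM; exact: mnorm.
- apply: filterS (L1_scaleE a f) => x e _.
  by rewrite e//= normrM EFinM.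
Qed.

Let norm0_eq0 f : L1_norm f = 0 -> f = 0.
Proof.
move=> f0; have := L1_normK f; rewrite f0 => /esym.
move=> /(ae_eq_integral_abs mu measurableT) H.
apply: L1_ext.
have /H : measurable_fun setT (EFin \o f) by exact/measurable_EFinP/measurable_L1.
move=> H'; apply: filterS (filterI H' L1_zeroE) => x [e1 e2] _.
by rewrite e2//=; have [] := e1 I.
Qed.

HB.instance Definition _ := Lmodule_isNormed.Build R L1 normD normZ norm0_eq0.

Lemma L1_normE f : `|f|%:E = (\int[mu]_x `|(f x)%:E|)%E.
Proof. exact: L1_normK. Qed.

End L1_normedModule.

Section convergence_in_measure.
Context d (T : measurableType d) (R : realType).
Variable mu : {measure set T -> \bar R}.

(* The same set as L1 mu, carrying the topology of local convergence in
   measure instead of the norm topology. *)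
Definition L1_measure : Type := L1 mu.
Implicit Types f g h : L1_measure.

HB.instance Definition _ := Choice.on L1_measure.
HB.instance Definition _ := GRing.Lmodule.on L1_measure.

Definition dev_set (A : set T) (e : R) f g : set T :=
  A `&` [set x | e < `|f x - g x|].

(* Entourages |f - g| <= e on A off a set of measure < e, for A of finite
   measure; convergence of sequences is characterized in cvg_in_measureP. *)
Definition in_measure_ent : set_system (L1_measure * L1_measure) :=
  filter_from
    [set Ae : set T * R | [/\ measurable Ae.1, (mu Ae.1 < +oo)%E & 0 < Ae.2]]
    (fun Ae => [set fg | (mu (dev_set Ae.1 Ae.2 fg.1 fg.2) < Ae.2%:E)%E]).

Lemma measurable_dev_set A e f g : measurable A -> measurable (dev_set A e f g).
Proof.
move=> mA.
have mfg : measurable_fun A (abse \o (EFin \o (fun x => f x - g x))).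
  apply/measurable_funTS/measurable_norm_EFin.
  by apply: measurable_funB; exact: measurable_L1.
have := emeasurable_fun_o_infty mA mfg e%:E.
by congr measurable; apply/seteqP; split => x [Ax /=]; rewrite lte_fin.
Qed.

Lemma dev_setC A e f g : dev_set A e f g = dev_set A e g f.
Proof. by apply/seteqP; split=> x [Ax /=]; rewrite distrC. Qed.

Let ent_filter : Filter in_measure_ent.
Proof.
apply: filter_from_filter.
  by exists (set0, 1) => /=; rewrite measure0; split.
move=> [A a] [B b] [/= mA muA a0] [/= mB muB b0].
exists (A `|` B, Num.min a b) => /=.
  split; [exact: measurableU| |by rewrite lt_min a0].
  by rewrite (le_lt_trans (measureU2 mu mA mB))// lte_add_pinfty.
move=> [f g] /= H; split => /=.
- rewrite (le_lt_trans _ (lt_le_trans H _))// ?lee_fin ?ge_min ?lexx//.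
  apply: le_measure; rewrite ?inE; [exact: measurable_dev_set| |].
    exact/measurable_dev_set/measurableU.
  by move=> x [Ax /= h]; split; [left|rewrite /= gt_min h].
- rewrite (le_lt_trans _ (lt_le_trans H _))// ?lee_fin ?ge_min ?lexx ?orbT//.
  apply: le_measure; rewrite ?inE; [exact: measurable_dev_set| |].
    exact/measurable_dev_set/measurableU.
  by move=> x [Bx /= h]; split; [right|rewrite /= gt_min h orbT].
Qed.

Local Open Scope relation_scope.

Let ent_diag E : in_measure_ent E -> diagonal `<=` E.
Proof.
move=> [[A e] [/= mA muA e0] AE] [f g] /diagonalP ->; apply: AE => /=.
rewrite (_ : dev_set _ _ _ _ = set0) ?measure0//.
by apply/seteqP; split=> x // [_ /=]; rewrite subrr normr0 ltNge (ltW e0).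
Qed.

Let ent_inv E : in_measure_ent E -> in_measure_ent E^-1.
Proof.
move=> [[A e] Ae AE]; exists (A, e) => // -[f g] /= H.
by apply: AE; rewrite /= dev_setC.
Qed.

Let ent_split E : in_measure_ent E ->
  exists2 B, in_measure_ent B & B \; B `<=` E.
Proof.
move=> [[A e] [/= mA muA e0] AE].
have e20 : 0 < e / 2 by rewrite divr_gt0.
exists [set fg | (mu (dev_set A (e / 2) fg.1 fg.2) < (e / 2)%:E)%E].
  by exists (A, e / 2).
move=> [f h] [g /= fg gh]; apply: AE => /=.
have mD := measurable_dev_set.
apply: (@le_lt_trans _ _
  (mu (dev_set A (e / 2) f g `|` dev_set A (e / 2) g h))).
  apply: le_measure; rewrite ?inE; [exact: mD|by apply: measurableU; exact: mD|].
  move=> x [Ax /= efh].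
  have [fgx|fgx] := ltP (e / 2) `|f x - g x|; first by left.
  right; split => //=; rewrite ltNge; apply/negP => ghx.
  move: efh; apply/negP; rewrite -leNgt (splitr e).
  by rewrite (le_trans (ler_distD (g x) _ _))// lerD.
apply: le_lt_trans (measureU2 mu _ _) _; [exact: mD..|].
by rewrite [in ltRHS](splitr e) EFinD lteD.
Qed.

HB.instance Definition _ :=
  isUniform.Build L1_measure ent_filter ent_diag ent_inv ent_split.

Local Close Scope relation_scope.

Lemma cvg_in_measureP (u : L1_measure^nat) f :
  u @ \oo --> f <->
  forall A, measurable A -> (mu A < +oo)%E -> forall e : R, 0 < e ->
    mu (dev_set A e (u n) f) @[n --> \oo] --> 0%E.
Proof.
split=> [uf A mA muA e e0|H].
  have small r : 0 < r ->
      \forall n \near \oo, (mu (dev_set A e (u n) f) < r%:E)%E.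
    move=> r0; have er0 : 0 < Num.min e r by rewrite lt_min e0.
    pose E := [set fg | (mu (dev_set A (Num.min e r) fg.1 fg.2)
                          < (Num.min e r)%:E)%E].
    have entE : entourage (E : set (L1_measure * L1_measure)).
      by exists (A, Num.min e r).
    have := uf _ (nbhs_entourage f entE).
    apply: (@filterS _ (nbhs \oo)) => n /xsectionP.
    rewrite /E /= dev_setC => h.
    rewrite (le_lt_trans _ (lt_le_trans h _))// ?lee_fin ?ge_min ?lexx ?orbT//.
    apply: le_measure; rewrite ?inE; [exact: measurable_dev_set..|].
    by move=> x [Ax /= ex]; split => //=; rewrite gt_min ex.
  apply/fine_cvgP; split.
    have := small _ ltr01; apply: filterS => n h.
    by rewrite ge0_fin_numE ?measure_ge0// (lt_trans h)// ltry.
  apply/cvgrPdist_lt => r r0; have := small _ r0; apply: filterS => n h /=.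
  rewrite sub0r normrN ger0_norm ?fine_ge0 ?measure_ge0//.
  by rewrite -lte_fin fineK// ge0_fin_numE ?measure_ge0// (lt_trans h)// ltry.
move=> B; rewrite -nbhs_entourageE => -[E [[A e] [/= mA muA e0] AE] EB].
have /fine_cvgP[fin /cvgrPdist_lt/(_ _ e0) small] := H A mA muA e e0.
apply: filterS (filterI fin small) => n [/= fn].
rewrite sub0r normrN ger0_norm ?fine_ge0 ?measure_ge0// => h.
apply/EB/xsectionP/AE => /=; rewrite dev_setC.
by rewrite -[ltLHS]fineK// lte_fin.
Qed.

End convergence_in_measure.

Definition measure_compact d (T : measurableType d) (R : realType)
    (mu : {measure set T -> \bar R}) (K : set (L1 mu)) : Prop :=
  compact (K : set (L1_measure mu)).

(* Main.v *)
Require Import Defs.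
From HB Require Import structures.
From mathcomp Require Import all_boot all_order all_algebra.
From mathcomp Require Import all_classical all_reals all_analysis.
From mathcomp Require Import measurable_realfun.
From mathcomp Require Import lra.

Set Implicit Arguments.
Unset Strict Implicit.
Unset Printing Implicit Defensive.
Import Order.TTheory GRing.Theory Num.Theory.
Import numFieldNormedType.Exports.
Local Open Scope classical_set_scope.
Local Open Scope ring_scope.

(** [T] has approximate fixed points [z] in [K], and by measure-compactness
    these cluster locally in measure at some [x] in [K].  For [z] close to [x]
    in measure, [|x - y| + |x - z| <= |z - y| + o(1)] in [L^1] for every fixed
    [y] (a Brezis-Lieb phenomenon).  Taking [y = T x] and using
    [|z - T x| <= |z - T z| + |z - x|] gives [|x - T x| <= o(1)], so [x] is a
    fixed point of [T]. *)

(** In either case the triangle inequality bounds the other distance on the left by [|c - b|] plus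
    the one that is at most [r]. Applied pointwise with [a = f x], [b = g x], [c = z x]. *)
Lemma dist_add_le (R : realDomainType) (a b c r : R) :
  `|a - c| <= r \/ `|a - b| <= r ->
  `|a - b| + `|a - c| <= `|c - b| + 2 * r.
Proof.
have := ler_distD c a b; have := ler_distD b a c; rewrite (distrC b c).
by move=> ? ? [] ?; lra.
Qed.

Lemma bounded_set_norm_le (R : realType) (V : normedModType R) (K : set V) :
  bounded_set K -> exists2 M, 0 < M & forall x, K x -> `|x| <= M.
Proof.
move=> /= bK.
have [M [M0 KM]] := filter_ex (filterI (nbhs_pinfty_gt (num_real 0)) bK).
by exists M.
Qed.

(** * Approximate fixed points of nonexpansive maps *)

Section approximate_fixpoints.
Context (R : realType) (V : normedModType R) (K : set V) (T : V -> V).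
Hypothesis K_nonempty : K !=set0.
Hypothesis K_bounded : bounded_set K.
Hypothesis K_convex : convex_set (K : set (convex_lmodType V)).
Hypothesis T_K : forall f, K f -> K (T f).
Hypothesis T_nonexpansive :
  forall f g, K f -> K g -> `|T f - T g| <= `|f - g|.

(* The contraction [S = t z0 + (1 - t) T] moves its Picard iterates by
   arbitrarily little, and [T] differs from [S] by at most [2 t M] on [K]. *)
Lemma nonexpansive_approx_fixpoint (e : R) : 0 < e ->
  exists2 z, K z & `|T z - z| <= e.
Proof.
move=> e0; have [z0 Kz0] := K_nonempty.
have [M M0 KM] := bounded_set_norm_le K_bounded.
have diam x y : K x -> K y -> `|x - y| <= 2 * M.
  by move=> Kx Ky; have := ler_normB x y; have := KM _ Kx; have := KM _ Ky; lra.
have D0 : 0 < 4 * M + e by lra.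
(* Chosen so that [t * (2 * M)], which bounds the gap between [T] and [S] on [K], is at most
   [e / 2]; the other half of [e] is left for [S z - z]. *)
pose t := e / (4 * M + e).
have t0 : 0 < t by rewrite divr_gt0.
have t1 : t < 1 by rewrite ltr_pdivrMr//; lra.
have tM : t * (2 * M) <= e / 2.
  by rewrite mulrAC ler_pdivrMr//; nra.
pose S z := t *: z0 + (1 - t) *: T z.
have SK z : K z -> K (S z).
  move=> Kz; have := K_convex (Itv01 (ltW t0) (ltW t1)) (mem_set Kz0)
    (mem_set (T_K Kz)).
  by rewrite inE.
have St a b : K a -> K b -> `|S a - S b| <= (1 - t) * `|a - b|.
  move=> Ka Kb; rewrite /S opprD addrACA subrr add0r -scalerBr normrZ.
  rewrite ger0_norm ?subr_ge0 ?(ltW t1)//.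
  by apply: ler_wpM2l; rewrite ?subr_ge0 ?(ltW t1)// T_nonexpansive.
have iK n : K (iter n S z0) by elim: n => //= n IH; exact: SK.
have iS n : `|S (iter n S z0) - iter n S z0| <= 2 * M * (1 - t) ^+ n.
  elim: n => [|n IH] /=; first by rewrite expr0 mulr1 diam//; exact: SK.
  rewrite (le_trans (St _ _ (SK _ (iK n)) (iK n)))// exprS mulrCA.
  by apply: ler_wpM2l; rewrite ?subr_ge0 ?(ltW t1).
have q1 : `|1 - t| < 1 by rewrite ger0_norm; lra.
have e20 : 0 < e / 2 by rewrite divr_gt0.
have /cvgrPdist_lt/(_ _ e20)/filter_ex[n] := cvg_geometric (2 * M) q1.
rewrite /geometric /= sub0r normrN => /(le_lt_trans (ler_norm _)) small.
exists (iter n S z0) => //; set z := iter n S z0.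
(* By the definition of [S], [T z - S z] is [t *: (T z - z0)]. *)
have -> : T z - z = (S z - z) + t *: (T z - z0).
  rewrite /S scalerBr scalerBl scale1r [RHS]addrAC -[X in _ = X - _]addrA.
  by rewrite subrKA [t *: z0 + _]addrC subrK.
rewrite (le_trans (ler_normD _ _))// normrZ (gtr0_norm t0).
have h1 := iS n; rewrite -/z in h1.
have h2 : t * `|T z - z0| <= t * (2 * M).
  by rewrite ler_wpM2l ?(ltW t0)// diam//; exact/T_K/iK.
lra.
Qed.

End approximate_fixpoints.

(** * Integral tails and the reverse triangle inequality near a point in measure *)

Section measure_estimates.
Context d (Omega : measurableType d) (R : realType).
Variable mu : {measure set Omega -> \bar R}.

Lemma L1_distE (f g : L1 mu) :
  (`|f - g|%:E = \int[mu]_x `|f x - g x|%:E)%E.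
Proof.
rewrite L1_normE; apply: ae_eq_integral => //.
- exact/measurable_norm_EFin/measurable_L1.
- by apply: measurable_norm_EFin; apply: measurable_funB; exact: measurable_L1.
- by apply: filterS (L1_subE f g) => x e _ /=; rewrite e.
Qed.

(** Finite unions [G n] of a sigma-finite cover exhaust the space and have finite measure; by
    monotone convergence the integrals over [G n] tend to the full integral, so the tails vanish. *)
Lemma integral_tail_lt (f : Omega -> \bar R) (e : R) :
  sigma_finite [set: Omega] mu -> mu.-integrable setT f ->
  (forall x, 0 <= f x)%E -> 0 < e ->
  exists A, [/\ measurable A, (mu A < +oo)%E &
    (\int[mu]_(x in ~` A) f x < e%:E)%E].
Proof.
move=> [F FT mF] intf f0 e0.
have /integrableP[mf _] := intf.
pose G n := \big[setU/set0]_(i < n) F i.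
have mG n : measurable (G n) by apply: bigsetU_measurable => i _; case: (mF i).
have GT : \bigcup_n G n = setT.
  apply/seteqP; split => // x; rewrite FT => -[n _ Fnx]; exists n.+1 => //.
  by rewrite /G big_ord_recr; right.
have ndG : nondecreasing_seq G.
  apply/nondecreasing_seqP => n; rewrite subsetEset /G big_ord_recr /=.
  by move=> x; left.
have := @ge0_nondecreasing_set_cvg_integral _ _ _ G f mu
  ndG mG (fun n => measurable_funTS mf)
  (fun n x _ => f0 x).
have finf : (\int[mu]_x f x)%E \is a fin_num by exact: integrable_fin_num.
rewrite GT -(fineK finf) => /fine_cvgP[fin /cvgrPdist_lt/(_ _ e0) close].
have [n [fn cn]] := filter_ex (filterI fin close).
exists (G n); split => //.
  elim: n {fn cn} => [|n IH]; first by rewrite /G big_ord0 measure0.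
  rewrite /G big_ord_recr /= (le_lt_trans (measureU2 _ _ _))//.
  - exact: mG.
  - by case: (mF n).
  - by rewrite lte_add_pinfty//; case: (mF n).
have := @ge0_integral_setU _ _ _ mu (G n) (~` G n) (mG n)
  (measurableC (mG n)) f (measurable_funTS mf) (fun x _ => f0 x)
  (introT disj_setPCl (@subset_refl _ _)).
rewrite setUv -(fineK finf) -(fineK fn) => tail.
rewrite (_ : \int[mu]_(x in ~` G n) f x =
  (fine (\int[mu]_x f x) - fine (\int[mu]_(x in G n) f x))%:E)%E; last first.
  by rewrite EFinB tail addeAC subee// add0e.
by rewrite lte_fin (le_lt_trans (ler_norm _)).
Qed.

(* The error in the reverse triangle inequality is at most
   [2 min (|f - g|, |f - z|)], dominated by the integrable [2 |f - g|] and
   small where [z] is close to [f]. *)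
Lemma L1_dist_add_near (f g : L1 mu) (e : R) :
  sigma_finite [set: Omega] mu -> 0 < e ->
  \forall z \near (f : L1_measure mu),
    `|f - g| + `|f - (z : L1 mu)| <= `|(z : L1 mu) - g| + e.
Proof.
move=> smu e0; set h := fun x => f x - g x.
have mh : measurable_fun setT h by apply: measurable_funB; exact: measurable_L1.
have mah := measurable_norm_EFin mh.
have ih : mu.-integrable setT (EFin \o h).
  apply/integrableP; split; first exact/measurable_EFinP.
  by rewrite -L1_distE ltry.
have e60 : 0 < e / 6 by rewrite divr_gt0.
have [A [mA muA tailA]] := integral_tail_lt smu (integrable_abse ih)
  (fun x => abse_ge0 _) e60.
(* Absolute continuity of the integral: [|h|] integrates to less than [e / 6] over any measurable
   set of measure below [r]. *)
have [r [r0 hr]] := integral_normr_continuous ih e60.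
pose a := fine (mu A).
have a0 : 0 <= a by exact: fine_ge0.
have aE : mu A = a%:E by rewrite fineK// ge0_fin_numE.
(* [s <= r] makes the deviation set [D] below small enough for [hr]; the second term keeps the
   integral of the constant [s] over [A] within [e / 6], with [a + 1] in place of [a] in case [A] is
   null. *)
pose s := Num.min r (e / 6 / (a + 1)).
have a10 : 0 < a + 1 by rewrite ltr_wpDl.
have s0 : 0 < s by rewrite lt_min r0 divr_gt0.
have sa : s * a <= e / 6.
  have : s <= e / 6 / (a + 1) by rewrite ge_min lexx orbT.
  by rewrite ler_pdivlMr//; nra.
rewrite /prop_near1 -nbhs_entourageE; exists
  [set fg : L1_measure mu * L1_measure mu |
    (mu (dev_set A s fg.1 fg.2) < s%:E)%E].
  by exists (A, s).
move=> z /xsectionP /=; set D := dev_set A s f z => muD.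
have mD : measurable D by exact: measurable_dev_set.
have intD : (\int[mu]_(x in D) `|h x|%:E < (e / 6)%:E)%E.
  have muDr : (mu D < r%:E)%E.
    by rewrite (lt_le_trans muD)// lee_fin ge_min lexx.
  have := hr D mD muDr; rewrite -lte_fin /Rintegral fineK//.
  apply: integrable_fin_num => //.
  by apply: integrableS (integrable_abse ih).
(* [k] dominates the pointwise minimum of [|f - g|] and [|f - z|]: off [A] and on [D] through
   [|f - g|], on the rest of [A] through [|f - z| <= s]. Each summand integrates to at most [e / 6],
   so [2 * k] integrates to at most [e]. *)
pose k1 := (cst s%:E) \_ A.
pose k2 := (abse \o (EFin \o h)) \_ (~` A).
pose k3 := (abse \o (EFin \o h)) \_ D.
pose k := fun x => (k1 x + k2 x + k3 x)%E.
have k10 x : (0 <= k1 x)%E by apply: erestrict_ge0 => y _; rewrite lee_fin ltW.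
have k20 x : (0 <= k2 x)%E by apply: erestrict_ge0 => y _ /=; rewrite lee_fin.
have k30 x : (0 <= k3 x)%E by apply: erestrict_ge0 => y _ /=; rewrite lee_fin.
have k120 x : (0 <= k1 x + k2 x)%E by rewrite adde_ge0.
have k0 x : (0 <= k x)%E by rewrite adde_ge0.
have mk1 : measurable_fun setT k1.
  by apply/(measurable_restrictT _ mA).
have mk2 : measurable_fun setT k2.
  by apply/(measurable_restrictT _ (measurableC mA))/measurable_funTS.
have mk3 : measurable_fun setT k3.
  by apply/(measurable_restrictT _ mD)/measurable_funTS.
have mk : measurable_fun setT k.
  by apply: emeasurable_funD => //; exact: emeasurable_funD.
have intk : (\int[mu]_x k x <= (e / 2)%:E)%E.
  rewrite ge0_integralD//; last exact: emeasurable_funD.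
  rewrite ge0_integralD//.
  rewrite -!integral_mkcond integral_cst// aE.
  rewrite (_ : e / 2 = e / 6 + e / 6 + e / 6); last by lra.
  by rewrite !EFinD; apply: leeD; [apply: leeD|]; rewrite ?lee_fin// ltW.
have mdist (u v : L1 mu) : measurable_fun setT (fun x => `|u x - v x|%:E).
  by apply: measurable_norm_EFin; apply: measurable_funB; exact: measurable_L1.
have : (`|f - g|%:E + `|f - z|%:E <= `|z - g|%:E + 2%:E * \int[mu]_x k x)%E.
  rewrite !L1_distE -ge0_integralZl// -!ge0_integralD//; last 2 first.
  - by move=> x _; rewrite mule_ge0.
  - exact: measurable_funeM.
  apply: ge0_le_integral => //.
  - by move=> x _; rewrite adde_ge0.
  - by apply: emeasurable_funD; exact: mdist.
  - by apply: emeasurable_funD; [exact: mdist|exact: measurable_funeM].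
  move=> x _.
  have [r' kr' fr'] : exists2 r' : R, (r'%:E <= k x)%E &
      `|f x - z x| <= r' \/ `|f x - g x| <= r'.
    have [Ax|nAx] := pselect (A x); last first.
      exists `|h x|; last by right.
      rewrite /k (le_trans _ (leeDl _ (k30 x)))//.
      rewrite (le_trans _ (leeDr _ (k10 x)))//.
      by rewrite /k2 /restrict mem_set.
    have [Dx|nDx] := pselect (D x).
      exists `|h x|; last by right.
      rewrite /k (le_trans _ (leeDr _ (k120 x)))//.
      by rewrite /k3 /restrict mem_set.
    exists s; last first.
      by left; rewrite leNgt; apply/negP => sx; apply: nDx; split.
    rewrite /k (le_trans _ (leeDl _ (k30 x)))//.
    rewrite (le_trans _ (leeDl _ (k20 x)))//.
    by rewrite /k1 /restrict mem_set.
  apply: (@le_trans _ _ (`|z x - g x| + 2 * r')%:E).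
    by rewrite lee_fin dist_add_le.
  by rewrite EFinD EFinM leeD2l// lee_wpmul2l.
move=> le1; rewrite -lee_fin !EFinD (le_trans le1)// leeD2l//.
rewrite (_ : e = 2 * (e / 2)); last by lra.
by rewrite EFinM lee_wpmul2l.
Qed.

End measure_estimates.

(** * Exact fixed points by compactness in measure *)

Theorem L1_fixpoint (d : measure_display) (Omega : measurableType d)
    (R : realType) (mu : {measure set Omega -> \bar R})
    (K : set (L1 mu)) (T : L1 mu -> L1 mu) :
  sigma_finite [set: Omega] mu -> K !=set0 -> bounded_set K ->
  convex_set (K : set (convex_lmodType (L1 mu))) -> measure_compact K ->
  (forall f, K f -> K (T f)) ->
  (forall f g, K f -> K g -> `|T f - T g| <= `|f - g|) ->
  exists2 x, K x & T x = x.
Proof.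
move=> smu K0 bK cK compK TK Tne.
pose N (e : R) := [set z | K z /\ `|T z - z| <= e].
(* The filter of approximate fixed points is taken on [L1_measure], so that compactness of [K] gives
   it a cluster point in measure. *)
pose F : set_system (L1_measure mu) := filter_from [set e : R | 0 < e] N.
have FF : ProperFilter F.
  apply: filter_from_proper; last first.
    move=> e /= e0.
    have [z Kz ze] := nonexpansive_approx_fixpoint K0 bK cK TK Tne e0.
    by exists z.
  apply: filter_from_filter; first by exists 1 => /=.
  move=> e1 e2 /= e10 e20; exists (Num.min e1 e2).
    by rewrite /= lt_min e10.
  by move=> z [Kz]; rewrite le_min => /andP[? ?]; split.
have FK : F K by exists 1 => //= z [].
have [x [Kx clx]] := compK F FF FK; exists x => //.
apply/eqP; rewrite -subr_eq0 -normr_le0; apply/ler_addgt0Pl => e e0.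
rewrite addr0.
have e20 : 0 < e / 2 by rewrite divr_gt0.
have FN : F (N (e / 2)) by exists (e / 2).
(* Here [|z - T x| <= |z - T z| + |T z - T x| <= e / 2 + |z - x|], and [close] costs another
   [e / 2]; the term [|x - z|] cancels, leaving [|x - T x| <= e]. *)
have [z [[Kz Tz] close]] := clx _ _ FN (L1_dist_add_near x (T x) smu e20).
have := ler_distD (T z) z (T x); have := Tne z x Kz Kx.
rewrite (distrC z (T z)) (distrC z x) (distrC (T x) x).
by move: Tz close => /=; lra.
Qed.

Theorem mainTheorem4 (d : measure_display) (Omega : measurableType d)
    (R : realType) (mu : {measure set Omega -> \bar R})
    (hmu : sigma_finite [set: Omega] mu)
    (K : set (L1 mu))
    (K_nonempty : K !=set0)
    (K_bounded : bounded_set K)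
    (K_closed : closed K)
    (K_convex : convex_set (K : set (convex_lmodType (L1 mu))))
    (K_compact : measure_compact K)
    (T : L1 mu -> L1 mu)
    (T_K : forall f, K f -> K (T f))
    (T_nonexpansive : forall f g, K f -> K g -> `|T f - T g| <= `|f - g|)
    (delta : R) (delta_gt0 : 0 < delta)
    (Q : L1 mu -> L1 mu)
    (Q_K : forall f, K f -> K (Q f))
    (Q_idem : forall f, K f -> Q (Q f) = Q f)
    (Q_close : forall f, K f -> `|Q f - f| <= delta) :
  let Tt := Q \o T in
  [/\ exists x, K x /\ `|Tt x - x| <= delta,
      forall x, K x -> T x = x ->
        `|Tt x - x| <= delta /\ ((Q @` K) x -> Tt x = x)
    & forall eps : R, delta < eps -> exists x, K x /\ `|Tt x - x| < eps].
Proof.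
move=> Tt.
(* At a fixed point of [T], [Tt x] is just [Q x]. *)
have fixed x : K x -> T x = x ->
    `|Tt x - x| <= delta /\ ((Q @` K) x -> Tt x = x).
  move=> Kx Tx; rewrite /Tt /= Tx; split; first exact: Q_close.
  by move=> [y Ky <-]; exact: Q_idem.
have [x Kx Tx] := L1_fixpoint hmu K_nonempty K_bounded K_convex K_compact
  T_K T_nonexpansive.
have [xd _] := fixed x Kx Tx.
split => //; first by exists x.
by move=> eps de; exists x; split => //; exact: le_lt_trans de.
Qed.
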